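(* Let $R$ be a commutative algebra over a field $K$ of characteristic zero, and let $f\in R$. (i) If $f$ has a nonzero sandwich Bernstein-Sato functional equation (one with $b(s)\neq 0$), then $f$ admits a Bernstein-Sato polynomial, and the Bernstein-Sato polynomial of $f$ divides the sandwich Bernstein-Sato polynomial of $f$. (ii) If $R$ is smooth over $K$, then the Bernstein-Sato polynomial of $f$ and the sandwich Bernstein-Sato polynomial of $f$ coincide. (iii) In general these two polynomials do not coincide: there exist such $K$, $R$ and $f\in R$ for which the Bernstein-Sato polynomial and the sandwich Bernstein-Sato polynomial of $f$ are different.
   Context: Differential operators: for a commutative $K$-algebra $R$, $D_{R|K}\subseteq \operatorname{End}_K(R)$ is the ring of $K$-linear differential operators: $D^0_{R|K}$ is the set of multiplication operators by elements of $R$ (identified with $R$), $D^{n+1}_{R|K}=\{\delta\in\operatorname{End}_K(R): [\delta,r]\in D^n_{R|K}\text{ for all } r\in R\}$, and $D_{R|K}=\bigcup_n D^n_{R|K}$, with composition as product. Differential operators on $R$ extend to differential operators on the localization $R_f$. Sandwich Bernstein-Sato polynomial: a sandwich Bernstein-Sato functional equation for $f\in R$ consists of finitely many $\alpha_i(s),\beta_i(s)\in D_{R|K}[s]$ and $b(s)\in K[s]$ with $\sum_i \alpha_i(n) f^{n+1}\beta_i(n)=b(n)f^n$ as operators in $D_{R|K}$ (products are compositions, $f^n$ is the multiplication operator) for all $n\in\mathbb{N}=\{0,1,2,\dots\}$. The set of $b(s)$ occurring is an ideal of $K[s]$; the sandwich Bernstein-Sato polynomial of $f$ is its monic generator, or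 $0$ if the ideal is zero. Bernstein-Sato polynomial: a Bernstein-Sato functional equation for $f$ consists of $\delta(s)\in D_{R|K}[s]$ and $b(s)\in K[s]$ such that $\delta(n)\cdot f^{n+1}=b(n)f^n$ in $R_f$ for all $n\in\mathbb{Z}$ (action of operators on elements). The Bernstein-Sato polynomial of $f$ is the minimal monic $b(s)$ occurring in such an equation, if one exists.
   Formalization: In (ii), f is also assumed to be a nonzerodivisor: for R = K and f = 0 the Bernstein-Sato polynomial is 1 while the sandwich one is s, so (ii) fails without this. *)

(* Defs.v *)
From HB Require Import structures.
From mathcomp Require Import all_boot all_order all_algebra.
From mathcomp Require Import generic_quotient.
From mathcomp Require Import ring.
From mathcomp Require mpoly.
From mathcomp Require Import boolp.

Set Implicit Arguments.
Unset Strict Implicit.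
Unset Printing Implicit Defensive.

Import GRing.Theory.
Local Open Scope ring_scope.

(* The K-algebra structure is given here by a ring morphism [k] into a possibly
   trivial ring, and not by [comAlgType K], because the definition is also used
   on the localization R_f, which is the zero ring when f is nilpotent. *)
Section DifferentialOperators.
Variables (K : fieldType) (A : comPzRingType) (k : {rmorphism K -> A}).

Definition Klinear (d : A -> A) : Prop :=
  (forall x y, d (x + y) = d x + d y) /\ (forall c x, d (k c * x) = k c * d x).

Definition commutator (d : A -> A) (r : A) : A -> A :=
  fun x => d (r * x) - r * d x.

Fixpoint diffop_le (n : nat) (d : A -> A) : Prop :=
  if n is n'.+1 then Klinear d /\ forall r, diffop_le n' (commutator d r)
  else exists a, d = (fun x => a * x).

Definition is_diffop (d : A -> A) : Prop := exists n, diffop_le n d.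

Lemma diffop_le_lin n d : diffop_le n d -> Klinear d.
Proof.
case: n => [[a ->]|n [] //]; split=> [x y|c x]; first by rewrite mulrDr.
by rewrite mulrCA.
Qed.

Lemma diffop_leW n d : diffop_le n d -> diffop_le n.+1 d.
Proof.
elim: n d => [|n IHn] d.
  move=> dd; split; first exact: (@diffop_le_lin 0).
  case: dd => a -> r; exists 0; apply/funext => x.
  by rewrite /commutator mulrCA subrr mul0r.
by case=> dlin dcomm; split=> // r; exact/IHn/dcomm.
Qed.

Lemma diffop_le_trans m n d : (m <= n)%N -> diffop_le m d -> diffop_le n d.
Proof.
move=> /subnK <- dd; elim: (n - m)%N => [|j IHj] //.
by rewrite addSn; exact: diffop_leW.
Qed.

Lemma diffop_le_mul a : diffop_le 0 (fun x => a * x).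
Proof. by exists a. Qed.

Lemma diffop_leB n d e : diffop_le n d -> diffop_le n e ->
  diffop_le n (fun x => d x - e x).
Proof.
elim: n d e => [|n IHn] d e.
  by case=> a -> [b ->]; exists (a - b); apply/funext => x; rewrite mulrBl.
case=> -[dD dZ] dc [[eD eZ] ec]; split.
  split=> [x y|c x]; first by rewrite dD eD opprD addrACA.
  by rewrite dZ eZ mulrBr.
move=> r; rewrite (_ : commutator _ r
   = fun x => commutator d r x - commutator e r x); last first.
  by apply/funext => x; rewrite /commutator mulrBr !opprD !opprK addrACA.
by apply: IHn; [exact: dc | exact: ec].
Qed.

Lemma diffop_leD n d e : diffop_le n d -> diffop_le n e ->
  diffop_le n (fun x => d x + e x).
Proof.
move=> dd de.
have d0 : diffop_le n (fun=> 0).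
  by rewrite (_ : (fun=> 0) = fun x => d x - d x);
    [exact: diffop_leB | apply/funext => x; rewrite subrr].
rewrite (_ : (fun x => _) = fun x => d x - (0 - e x)).
  by apply: diffop_leB => //; exact: diffop_leB.
by apply/funext => x; rewrite sub0r opprK.
Qed.

Lemma diffop_le0 n : diffop_le n (fun=> 0).
Proof.
apply: (@diffop_le_trans 0) => //; exists 0.
by apply/funext => x; rewrite mul0r.
Qed.

Lemma commutator_mul a r : commutator (fun x => a * x) r = fun=> 0.
Proof. by apply/funext => x; rewrite /commutator mulrCA subrr. Qed.

Lemma diffop_le_comp s m n d e : (m + n <= s)%N ->
  diffop_le m d -> diffop_le n e -> diffop_le s (fun x => d (e x)).
Proof.
elim: s m n d e => [|s IHs] m n d e mns dd de.
  move: mns dd de; rewrite leqn0 addn_eq0 => /andP[/eqP -> /eqP ->].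
  move=> [a ->] [b ->].
  by exists (a * b); apply/funext => x; rewrite mulrA.
have [dD dZ] := diffop_le_lin dd; have [eD eZ] := diffop_le_lin de.
have dB x y : d (x - y) = d x - d y.
  by apply/eqP; rewrite eq_sym subr_eq -dD subrK.
split=> [|r]; first by split=> [x y|c x]; rewrite ?eD ?dD ?eZ ?dZ.
rewrite (_ : commutator _ r
   = fun x => d (commutator e r x) + commutator d r (e x)); last first.
  by apply/funext => x; rewrite /commutator dB addrA subrK.
apply: diffop_leD.
  case: n de mns => [[b ->] _|n [_ de] mns].
    rewrite commutator_mul (_ : (fun=> d 0) = fun=> 0); first exact: diffop_le0.
    by apply/funext => _; rewrite -[X in d X](subrr 0) dB subrr.
  by apply: IHs dd (de r); rewrite -ltnS -addnS.
case: m dd mns => [[a ->] _|m [_ dd] mns].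
  by rewrite commutator_mul; exact: diffop_le0.
by apply: IHs (dd r) de; rewrite -ltnS -addSn.
Qed.

Lemma is_diffopB d e : is_diffop d -> is_diffop e ->
  is_diffop (fun x => d x - e x).
Proof.
move=> [m dd] [n de]; exists (maxn m n); apply: diffop_leB.
  by apply: diffop_le_trans dd; rewrite leq_maxl.
by apply: diffop_le_trans de; rewrite leq_maxr.
Qed.

Lemma is_diffop_comp d e : is_diffop d -> is_diffop e ->
  is_diffop (fun x => d (e x)).
Proof.
by move=> [m dd] [n de]; exists (m + n)%N; exact: diffop_le_comp dd de.
Qed.

Lemma is_diffop_mul a : is_diffop (fun x => a * x).
Proof. by exists 0%N, a. Qed.

Lemma is_diffop_lin d : is_diffop d -> Klinear d.
Proof. by case=> n /diffop_le_lin. Qed.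

End DifferentialOperators.

(* [diffop R] is the ring D_{R|K}, with composition as product. *)
Section RingOfDifferentialOperators.
Variables (K : fieldType) (R : comAlgType K).

Record diffop := Diffop
  { diffop_fun :> R -> R ; diffopP : is_diffop (in_alg R) diffop_fun }.

Lemma diffop_eqP (d e : diffop) : d =1 e -> d = e.
Proof.
case: d e => [d dP] [e eP] /= /funext de.
by case: _ / de eP => eP; congr Diffop; exact: Prop_irrelevance.
Qed.

HB.instance Definition _ := gen_eqMixin diffop.
HB.instance Definition _ := gen_choiceMixin diffop.

Definition mulop (a : R) : diffop := Diffop (is_diffop_mul (in_alg R) a).

Let sub_op (d e : diffop) : diffop :=
  Diffop (is_diffopB (diffopP d) (diffopP e)).
Let opp_op (d : diffop) : diffop := sub_op (mulop 0) d.
Let add_op (d e : diffop) : diffop := sub_op d (opp_op e).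
Let comp_op (d e : diffop) : diffop :=
  Diffop (is_diffop_comp (diffopP d) (diffopP e)).

Let add_opE d e x : add_op d e x = d x + e x.
Proof. by rewrite /= mul0r sub0r opprK. Qed.

Let diffop_funD (d : diffop) x y : d (x + y) = d x + d y.
Proof. by case: (is_diffop_lin (diffopP d)). Qed.

Let add_opA : associative add_op.
Proof. by move=> d e g; apply: diffop_eqP => x; rewrite !add_opE addrA. Qed.

Let add_opC : commutative add_op.
Proof. by move=> d e; apply: diffop_eqP => x; rewrite !add_opE addrC. Qed.

Let add_op0 : left_id (mulop 0) add_op.
Proof. by move=> d; apply: diffop_eqP => x; rewrite add_opE /= mul0r add0r. Qed.

Let add_opN : left_inverse (mulop 0) opp_op add_op.
Proof.
by move=> d; apply: diffop_eqP => x; rewrite add_opE /= mul0r sub0r addNr.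
Qed.

HB.instance Definition _ :=
  GRing.isZmodule.Build diffop add_opA add_opC add_op0 add_opN.

Let comp_opA : associative comp_op.
Proof. by move=> d e g; exact: diffop_eqP. Qed.

Let comp_op1 : left_id (mulop 1) comp_op.
Proof. by move=> d; apply: diffop_eqP => x; rewrite /= mul1r. Qed.

Let comp_op1r : right_id (mulop 1) comp_op.
Proof. by move=> d; apply: diffop_eqP => x; rewrite /= mul1r. Qed.

Let comp_opDl : left_distributive comp_op add_op.
Proof.
by move=> d e g; apply: diffop_eqP => x; rewrite add_opE /= mul0r sub0r opprK.
Qed.

Let comp_opDr : right_distributive comp_op add_op.
Proof.
move=> d e g; apply: diffop_eqP => x.
by rewrite [LHS]/= [RHS]add_opE mul0r sub0r opprK diffop_funD.
Qed.

Let op1_neq0 : mulop 1 != 0.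
Proof.
apply/eqP => /(congr1 (fun d : diffop => d 1)) /= /eqP.
by rewrite !mulr1 oner_eq0.
Qed.

HB.instance Definition _ := GRing.Zmodule_isNzRing.Build diffop
  comp_opA comp_op1 comp_op1r comp_opDl comp_opDr op1_neq0.

Lemma diffopDE (d e : diffop) x : (d + e) x = d x + e x.
Proof. exact: add_opE. Qed.

Lemma diffopME (d e : diffop) x : (d * e) x = d (e x).
Proof. by []. Qed.

Lemma diffop0E x : (0 : diffop) x = 0.
Proof. exact: mul0r. Qed.

Lemma diffop1E x : (1 : diffop) x = x.
Proof. exact: mul1r. Qed.

End RingOfDifferentialOperators.

(* R_f may be the zero ring, so it is only a [comPzRingType]. *)
Section Localization.
Local Open Scope quotient_scope.
Variables (R : comNzRingType) (f : R).

Definition eqloc (x y : R * nat) : bool :=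
  `[< exists t, f ^+ t * (x.1 * f ^+ y.2) = f ^+ t * (y.1 * f ^+ x.2) >].

Let eqloc_refl : reflexive eqloc.
Proof. by move=> x; apply/asboolP; exists 0%N. Qed.

Let eqloc_sym : symmetric eqloc.
Proof. by move=> x y; apply/asboolP/asboolP => -[t e]; exists t. Qed.

Let eqloc_trans : transitive eqloc.
Proof.
move=> [b k] [a m] [c l] /asboolP[t /= e1] /asboolP[u /= e2].
apply/asboolP; exists (t + u + k)%N => /=; rewrite !exprD.
have -> : f ^+ t * f ^+ u * f ^+ k * (a * f ^+ l)
        = f ^+ u * f ^+ l * (f ^+ t * (a * f ^+ k)).
  by rewrite !mulrA; ring.
rewrite e1.
have -> : f ^+ u * f ^+ l * (f ^+ t * (b * f ^+ m))
        = f ^+ t * f ^+ m * (f ^+ u * (b * f ^+ l)) by ring.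
by rewrite e2; ring.
Qed.

Canonical eqloc_equiv := EquivRel eqloc eqloc_refl eqloc_sym eqloc_trans.

Definition localization := {eq_quot eqloc}.

HB.instance Definition _ : EqQuotient _ eqloc localization :=
  EqQuotient.on localization.
HB.instance Definition _ := Choice.on localization.

Definition loc_mk (a : R) (m : nat) : localization := \pi_localization (a, m).

Lemma loc_mk_eqP a m b k :
  loc_mk a m = loc_mk b k <->
  exists t, f ^+ t * (a * f ^+ k) = f ^+ t * (b * f ^+ m).
Proof.
split=> [/eqP|ex]; first by rewrite /loc_mk eqmodE => /asboolP.
by apply/eqP; rewrite /loc_mk eqmodE; apply/asboolP.
Qed.

Lemma loc_mkP (x : localization) : exists a m, x = loc_mk a m.
Proof.
exists (repr x).1, (repr x).2.
by rewrite /loc_mk -surjective_pairing reprK.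
Qed.

Let add (x y : localization) : localization :=
  loc_mk ((repr x).1 * f ^+ (repr y).2 + (repr y).1 * f ^+ (repr x).2)
     ((repr x).2 + (repr y).2).
Let opp (x : localization) : localization := loc_mk (- (repr x).1) (repr x).2.
Let mul (x y : localization) : localization :=
  loc_mk ((repr x).1 * (repr y).1) ((repr x).2 + (repr y).2).

Let repr_mk a m : exists t,
  f ^+ t * ((repr (loc_mk a m)).1 * f ^+ m)
  = f ^+ t * (a * f ^+ (repr (loc_mk a m)).2).
Proof. by apply/loc_mk_eqP; rewrite {1}/loc_mk -surjective_pairing reprK. Qed.

Let addE a m b k :
  add (loc_mk a m) (loc_mk b k) = loc_mk (a * f ^+ k + b * f ^+ m) (m + k).
Proof.
have [t et] := repr_mk a m; have [u eu] := repr_mk b k.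
apply/loc_mk_eqP; exists (t + u)%N; move: et eu; rewrite !exprD.
case: (repr _) => a' m' /=; case: (repr _) => b' k' /= et eu.
transitivity (f ^+ u * f ^+ k * f ^+ k' * (f ^+ t * (a' * f ^+ m))
  + f ^+ t * f ^+ m * f ^+ m' * (f ^+ u * (b' * f ^+ k))); first by ring.
by rewrite et eu; ring.
Qed.

Let oppE a m : opp (loc_mk a m) = loc_mk (- a) m.
Proof.
have [t et] := repr_mk a m; apply/loc_mk_eqP; exists t; move: et.
by case: (repr _) => a' m' /= et; rewrite !mulNr !mulrN et.
Qed.

Let mulE a m b k : mul (loc_mk a m) (loc_mk b k) = loc_mk (a * b) (m + k).
Proof.
have [t et] := repr_mk a m; have [u eu] := repr_mk b k.
apply/loc_mk_eqP; exists (t + u)%N; move: et eu; rewrite !exprD.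
case: (repr _) => a' m' /=; case: (repr _) => b' k' /= et eu.
transitivity ((f ^+ t * (a' * f ^+ m)) * (f ^+ u * (b' * f ^+ k))).
  by ring.
by rewrite et eu; ring.
Qed.

Let eq_mk a m b k : a * f ^+ k = b * f ^+ m -> loc_mk a m = loc_mk b k.
Proof. by move=> e; apply/loc_mk_eqP; exists 0%N; rewrite e. Qed.

Let addA : associative add.
Proof.
move=> x y z; have [a [m ->]] := loc_mkP x; have [b [k ->]] := loc_mkP y.
have [c [l ->]] := loc_mkP z; rewrite !addE; apply: eq_mk; rewrite !exprD; ring.
Qed.

Let addC : commutative add.
Proof.
move=> x y; have [a [m ->]] := loc_mkP x; have [b [k ->]] := loc_mkP y.
by rewrite !addE; apply: eq_mk; rewrite !exprD; ring.
Qed.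

Let add0 : left_id (loc_mk 0 0) add.
Proof.
move=> x; have [a [m ->]] := loc_mkP x.
by rewrite !addE; apply: eq_mk; rewrite !exprD; ring.
Qed.

Let addN : left_inverse (loc_mk 0 0) opp add.
Proof.
move=> x; have [a [m ->]] := loc_mkP x.
by rewrite oppE addE; apply: eq_mk; rewrite !exprD; ring.
Qed.

HB.instance Definition _ := GRing.isZmodule.Build
  localization addA addC add0 addN.

Let mulA : associative mul.
Proof.
move=> x y z; have [a [m ->]] := loc_mkP x; have [b [k ->]] := loc_mkP y.
have [c [l ->]] := loc_mkP z; rewrite !mulE; apply: eq_mk; rewrite !exprD; ring.
Qed.

Let mulC : commutative mul.
Proof.
move=> x y; have [a [m ->]] := loc_mkP x; have [b [k ->]] := loc_mkP y.
by rewrite !mulE; apply: eq_mk; rewrite !exprD; ring.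
Qed.

Let mul1 : left_id (loc_mk 1 0) mul.
Proof. by move=> x; have [a [m ->]] := loc_mkP x; rewrite mulE mul1r add0n. Qed.

Let mulD : left_distributive mul add.
Proof.
move=> x y z; have [a [m ->]] := loc_mkP x; have [b [k ->]] := loc_mkP y.
have [c [l ->]] := loc_mkP z; rewrite addE !mulE addE.
by apply: eq_mk; rewrite !exprD; ring.
Qed.

HB.instance Definition _ :=
  GRing.Zmodule_isComPzRing.Build localization mulA mulC mul1 mulD.

Lemma loc_mkD a m b k :
  loc_mk a m + loc_mk b k = loc_mk (a * f ^+ k + b * f ^+ m) (m + k).
Proof. exact: addE. Qed.

Lemma loc_mkN a m : - loc_mk a m = loc_mk (- a) m.
Proof. exact: oppE. Qed.

Lemma loc_mkM a m b k : loc_mk a m * loc_mk b k = loc_mk (a * b) (m + k).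
Proof. exact: mulE. Qed.

Definition to_loc (a : R) : localization := loc_mk a 0.

Let to_loc_zmod : zmod_morphism to_loc.
Proof. by move=> a b; rewrite /to_loc loc_mkN loc_mkD !mulr1. Qed.

Let to_loc_mul : monoid_morphism to_loc.
Proof. by split=> // a b; rewrite /to_loc loc_mkM. Qed.

HB.instance Definition _ := GRing.isZmodMorphism.Build
  R localization to_loc to_loc_zmod.
HB.instance Definition _ := GRing.isMonoidMorphism.Build
  R localization to_loc to_loc_mul.

(* f ^ n for an integer n; recall that [Negz m] is - m.+1. *)
Definition loc_pow (n : int) : localization :=
  match n with Posz m => to_loc (f ^+ m) | Negz m => loc_mk 1 m.+1 end.

End Localization.

Section BernsteinSato.
Variables (K : fieldType) (R : comAlgType K) (f : R).

(* In [diffop R], n%:R is the multiplication by n, so p.1.[n%:R] is the operator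
   alpha_i(n). *)
Definition sandwich_eqn (b : {poly K}) : Prop :=
  exists ab : seq ({poly diffop R} * {poly diffop R}), forall n : nat,
    \sum_(p <- ab) p.1.[n%:R] * mulop (f ^+ n.+1) * p.2.[n%:R]
      = mulop (b.[n%:R] *: f ^+ n).

(* p = 0 is the case where the ideal of all b satisfying [sandwich_eqn] is zero,
   since 0 %| b means b = 0. *)
Definition is_sandwich_BS_poly (p : {poly K}) : Prop :=
  (p \is monic \/ p = 0) /\ forall b, sandwich_eqn b <-> p %| b.

Definition K_to_loc : {rmorphism K -> localization f} := to_loc f \o in_alg R.

(* [d'] is the extension of [d] to a differential operator on R_f; it exists and
   is unique for every d in D_{R|K}. *)
Definition extends_to_loc (d : diffop R) (d' : localization f -> localization f)
    : Prop :=
  is_diffop K_to_loc d' /\ forall r, d' (to_loc f r) = to_loc f (d r).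

Definition BS_eqn (b : {poly K}) : Prop :=
  exists delta : {poly diffop R}, forall n : int,
    exists2 d', extends_to_loc delta.[n%:~R] d' &
      d' (loc_pow f (n + 1)) = K_to_loc b.[n%:~R] * loc_pow f n.

Definition is_BS_poly (p : {poly K}) : Prop :=
  [/\ p \is monic, BS_eqn p &
      forall b, b \is monic -> BS_eqn b -> (size p <= size b)%N].

End BernsteinSato.

Section Smooth.
Import mpoly.
Variables (K : fieldType) (R : comAlgType K).

Definition finitely_presented : Prop :=
  exists (n : nat) (g : 'I_n -> R) (m : nat) (rel : 'I_m -> {mpoly K[n]}),
    (forall r, exists p, mmap (in_alg R) g p = r) /\
    (forall p, mmap (in_alg R) g p = 0 <->
       exists c : 'I_m -> {mpoly K[n]}, p = \sum_j c j * rel j).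

(* Lifting along C -> C / I with I ^ 2 = 0; here B stands for C / I. *)
Definition formally_smooth : Prop :=
  forall (C B : comAlgType K) (q : {lrmorphism C -> B}),
    (forall y, exists x, q x = y) ->
    (forall x y, q x = 0 -> q y = 0 -> x * y = 0) ->
    forall phi : {lrmorphism R -> B},
      exists psi : {lrmorphism R -> C}, forall r, q (psi r) = phi r.

Definition smooth : Prop := finitely_presented /\ formally_smooth.

End Smooth.

(* Main.v *)
(* Applying a sandwich equation to 1 turns it into an equation
   delta(n) f^(n+1) = b(n) f^n for n in nat. For an operator d of order k, the
   function n |-> f^-n d(f^n) on the integers has vanishing (k+1)-st finite
   difference, so that the equation extends from nat to all of int.

   If R is smooth, lifting the identity of R along a square-zero extension
   contained in R + R^n yields derivations D_i with
   [d, r] = \sum_i [d, x_i] D_i(r) up to operators of lower order; by Euler's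
   identity k d - \sum_i [d, x_i] D_i then has order less than k = ord d, and
   in characteristic 0 the ring D_{R|K} is generated by R and derivations. Since
   D(g) = [D, g] for a derivation D, multiplication by d(g) is a sum of
   alpha g beta with alpha and beta independent of g, and a Bernstein-Sato
   equation becomes a sandwich equation.

   For R = K[x, y]/(xy) and f = x + y, the operator x d_x^2 + y d_y^2 gives the
   Bernstein-Sato equation with b = s (s + 1). Every differential operator maps
   x into x R, so a sandwich equation applied to x yields
   gamma(n) x^(n+2) = c(n) x^(n+1); at n = -2 the left-hand side is in the image
   of R in R_x, which forces c(-2) = 0. *)

Require Import Defs.
From HB Require Import structures.
From mathcomp Require Import all_boot all_order all_algebra.
From mathcomp Require Import ring boolp.
From mathcomp Require mpoly.

Set Implicit Arguments.
Unset Strict Implicit.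
Unset Printing Implicit Defensive.

Import GRing.Theory.
Local Open Scope ring_scope.

(** * Differential operators on a localization *)

Section Order.
Variables (K : fieldType) (A : comPzRingType) (k : {rmorphism K -> A}).
Implicit Types (d e : A -> A) (n : nat).

Lemma is_diffopD d e : is_diffop k d -> is_diffop k e ->
  is_diffop k (fun x => d x + e x).
Proof.
move=> [m dd] [n de]; exists (maxn m n); apply: diffop_leD.
  by apply: diffop_le_trans dd; rewrite leq_maxl.
by apply: diffop_le_trans de; rewrite leq_maxr.
Qed.

Lemma is_diffop_commutator d r :
  is_diffop k d -> is_diffop k (commutator d r).
Proof.
move=> dd; apply: is_diffopB.
  by apply: is_diffop_comp dd _; exact: is_diffop_mul.
by apply: is_diffop_comp dd; exact: is_diffop_mul.
Qed.

Lemma KlinearB d x y : Klinear k d -> d (x - y) = d x - d y.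
Proof. by case=> dD _; apply/eqP; rewrite eq_sym subr_eq -dD subrK. Qed.

Lemma Klinear0 d : Klinear k d -> d 0 = 0.
Proof. by move=> dL; rewrite -[X in d X](subrr 0) (KlinearB _ _ dL) subrr. Qed.

Lemma Klinear_sum d I (r : seq I) (P : pred I) (F : I -> A) : Klinear k d ->
  d (\sum_(i <- r | P i) F i) = \sum_(i <- r | P i) d (F i).
Proof.
move=> dL; apply: (big_morph d); last exact: Klinear0 dL.
by case: dL.
Qed.

Lemma Klinear_commutator d r : Klinear k d -> Klinear k (commutator d r).
Proof.
move=> [dD dZ]; split=> [x y|c x]; rewrite /commutator.
  by rewrite mulrDr !dD mulrDr opprD addrACA.
by rewrite mulrCA !dZ mulrBr [r * _]mulrCA.
Qed.

Lemma Klinear_intX d (n : int) i x : Klinear k d ->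
  d (n%:~R ^+ i * x) = n%:~R ^+ i * d x.
Proof. by case=> _ dZ; rewrite -(rmorph_int k) -(rmorphXn k) dZ. Qed.

End Order.

Section ExtensionToLocalization.
Variables (K : fieldType) (R : comAlgType K) (f : R).
Local Notation k := (in_alg R).
Local Notation Rf := (localization f).
Local Notation kf := (K_to_loc f).
Local Notation "x %:F" := (to_loc f x).
Implicit Types (d e : Rf -> Rf).

Lemma loc_mkE (a : R) m : loc_mk f a m = a%:F * loc_mk f 1 m.
Proof. by rewrite /to_loc loc_mkM mulr1. Qed.

Lemma loc_mk1V m : loc_mk f 1 m * (f ^+ m)%:F = 1.
Proof.
rewrite loc_mkM mul1r addn0; apply/loc_mk_eqP.
by exists 0%N; rewrite !mul1r mulr1.
Qed.

Lemma to_loc_eq0 (a : R) : a%:F = 0 -> exists t, f ^+ t * a = 0.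
Proof. by case/loc_mk_eqP=> t; rewrite !mul0r mulr0 mulr1; exists t. Qed.

Lemma exp_eq0_to_loc t (a : R) : f ^+ t * a = 0 -> a%:F = 0.
Proof. by move=> h; apply/loc_mk_eqP; exists t; rewrite !mulr1 h mulr0. Qed.

Lemma to_locX_inj m (x y : Rf) : (f ^+ m)%:F * x = (f ^+ m)%:F * y -> x = y.
Proof.
by move=> e; rewrite -(mul1r x) -(mul1r y) -(loc_mk1V m) -!mulrA e.
Qed.

(** Induction on the order: [[d, f^m]] also kills the image of [R], hence is zero, so
    [f^m d(a / f^m) = d(a) = 0], and [f^m] is a unit. *)
Lemma diffop_loc_eq0 d : is_diffop kf d ->
  (forall r : R, d r%:F = 0) -> forall x, d x = 0.
Proof.
case=> n; elim: n d => [|n IHn] d.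
  by case=> a -> /(_ 1); rewrite rmorph1 mulr1 => -> x; rewrite mul0r.
move=> [dL dC] d0 x; have [a [m ->]] := loc_mkP x.
apply: (@to_locX_inj m); rewrite mulr0.
have /eqP : commutator d (f ^+ m)%:F (loc_mk f a m) = 0.
  apply: IHn => [|r]; first exact: dC.
  by rewrite /commutator -rmorphM !d0 mulr0 subrr.
by rewrite /commutator loc_mkE mulrCA [X in _ * X]mulrC loc_mk1V mulr1
  d0 sub0r oppr_eq0 => /eqP.
Qed.

Lemma diffop_loc_unique d e : is_diffop kf d -> is_diffop kf e ->
  (forall r : R, d r%:F = e r%:F) -> forall x, d x = e x.
Proof.
move=> dd de h x; apply/eqP; rewrite -subr_eq0; apply/eqP.
apply: (diffop_loc_eq0 (is_diffopB dd de)) => r.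
by rewrite h subrr.
Qed.

(* The extension satisfies d'(a / f^m) = (d a - [d, f^m]'(a / f^m)) / f^m, where
   [d, f^m]' is the extension of an operator of smaller order. *)
Lemma diffop_le_extends n (d : R -> R) : diffop_le k n d ->
  exists2 d', diffop_le kf n d' & forall r : R, d' r%:F = (d r)%:F.
Proof.
elim: n d => [|n IHn] d.
  case=> a ->; exists (fun x => a%:F * x); first exact: diffop_le_mul.
  by move=> r; rewrite rmorphM.
case=> dL dC.
have /choice[D DP] : forall r, exists d', diffop_le kf n d' /\
    forall s : R, d' s%:F = (commutator d r s)%:F.
  by move=> r; have [d' ? ?] := IHn _ (dC r); exists d'.
have Dop r : is_diffop kf (D r) by exists n; case: (DP r).
have DF r s : D r s%:F = (commutator d r s)%:F by case: (DP r).
have DL r : Klinear kf (D r) := is_diffop_lin (Dop r).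
(* Both sides extend the double commutator of [d] with [r] and [s], which is symmetric because [R]
   is commutative; extensions are unique. *)
have DC r s x : commutator (D r) s%:F x = commutator (D s) r%:F x.
  apply: diffop_loc_unique => [||q]; try exact: is_diffop_commutator.
  rewrite /commutator -!rmorphM !DF -!rmorphM -!rmorphB /commutator.
  by congr (to_loc f _); rewrite mulrCA; ring.
(* [d] preserves [f]-power torsion: if [f^t c = 0], the extension of [[d, f^t]] at [c] shows that
   [f^t d(c)] is 0 in the localization. *)
have d_tors c : c%:F = 0 -> (d c)%:F = 0.
  move=> c0; have [t ct0] := to_loc_eq0 c0.
  apply: (@to_locX_inj t); rewrite mulr0 -rmorphM.
  have := DF (f ^+ t) c; rewrite c0 (Klinear0 (DL _)) /commutator ct0.
  rewrite (Klinear0 dL) sub0r rmorphN => /eqP.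
  by rewrite eq_sym oppr_eq0 => /eqP.
pose E a m := loc_mk f 1 m * ((d a)%:F - D (f ^+ m) (loc_mk f a m)).
have fE a m : (f ^+ m)%:F * E a m = (d a)%:F - D (f ^+ m) (loc_mk f a m).
  by rewrite /E mulrCA mulrA loc_mk1V mul1r.
have mkf a m : (f ^+ m)%:F * loc_mk f a m = a%:F.
  by rewrite loc_mkE mulrCA [X in _ * X]mulrC loc_mk1V mulr1.
(* Independence of the representative: after multiplication by [f^m f^l] this is the symmetry [DC]
   at [x], where [d] does not distinguish [f^l a] from [f^m b] because their difference is
   torsion. *)
have Ewd a m b l : loc_mk f a m = loc_mk f b l -> E a m = E b l.
  move=> ab; apply: (@to_locX_inj m); apply: (@to_locX_inj l).
  rewrite fE [RHS]mulrCA fE -ab; set x := loc_mk f a m.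
  have xa : (f ^+ m)%:F * x = a%:F by exact: mkf.
  have xb : (f ^+ l)%:F * x = b%:F by rewrite /x ab mkf.
  have := DC (f ^+ l) (f ^+ m) x; rewrite /commutator xa xb !DF /commutator.
  have /d_tors : (f ^+ l * a - f ^+ m * b)%:F = 0.
    by rewrite rmorphB !rmorphM /= -xa -xb mulrCA subrr.
  rewrite (KlinearB _ _ dL) !rmorphB !rmorphM /= => /eqP; rewrite subr_eq0.
  move=> /eqP -> /eqP; rewrite -subr_eq0 => /eqP h.
  by apply/eqP; rewrite -subr_eq0 -[X in _ == X]oppr0 -h; apply/eqP; ring.
have /choice[d' d'E] : forall x, exists y, forall a m,
    x = loc_mk f a m -> y = E a m.
  move=> x; have [a [m ->]] := loc_mkP x.
  by exists (E a m) => b l; exact: Ewd.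
have fd' a m : (f ^+ m)%:F * d' (loc_mk f a m) =
    (d a)%:F - D (f ^+ m) (loc_mk f a m) by rewrite (d'E _ a m).
have d'F r : d' r%:F = (d r)%:F.
  have := fd' r 0%N; rewrite expr0 rmorph1 mul1r => ->.
  by rewrite DF /commutator !mul1r subrr rmorph0 subr0.
have d'D x y : d' (x + y) = d' x + d' y.
  have [a [m ->]] := loc_mkP x; have [b [l ->]] := loc_mkP y.
  have -> : loc_mk f a m = loc_mk f (a * f ^+ l) (m + l).
    by apply/loc_mk_eqP; exists 0%N; rewrite !exprD; ring.
  have -> : loc_mk f b l = loc_mk f (b * f ^+ m) (m + l).
    by apply/loc_mk_eqP; exists 0%N; rewrite !exprD; ring.
  move: (m + l)%N (a * _) (b * _) => {}m {}a {}b.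
  have -> : loc_mk f a m + loc_mk f b m = loc_mk f (a + b) m.
    rewrite loc_mkD; apply/loc_mk_eqP; exists 0%N; rewrite !exprD; ring.
  apply: (@to_locX_inj m); rewrite mulrDr !fd'.
  have -> : loc_mk f (a + b) m = loc_mk f a m + loc_mk f b m.
    rewrite loc_mkD; apply/loc_mk_eqP; exists 0%N; rewrite !exprD; ring.
  by rewrite (proj1 (DL _)) (proj1 dL) rmorphD /=; ring.
have d'C (r : R) x : commutator d' r%:F x = D r x.
  have [a [m ->]] := loc_mkP x; rewrite /commutator.
  have -> : r%:F * loc_mk f a m = loc_mk f (r * a) m by rewrite loc_mkM.
  apply: (@to_locX_inj m); rewrite mulrBr fd' mulrCA fd'.
  have -> : loc_mk f (r * a) m = r%:F * loc_mk f a m by rewrite loc_mkM.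
  have := DC r (f ^+ m) (loc_mk f a m).
  rewrite /commutator mkf DF /commutator rmorphB rmorphM /=.
  move=> /eqP; rewrite subr_eq => /eqP /eqP; rewrite subr_eq => /eqP ->; ring.
have d'L : Klinear kf d'.
  split=> // c x; have := d'C (in_alg R c) x.
  rewrite (diffop_loc_eq0 (Dop (in_alg R c))); last first.
    by move=> s; rewrite DF /commutator (proj2 dL) subrr rmorph0.
  by move=> /eqP; rewrite subr_eq0 => /eqP.
exists d' => //; split=> // y; have [b [l ->]] := loc_mkP y.
(* As composites, [[d', b f^-l] = [d', b] f^-l - b f^-l [d', f^l] f^-l], and the commutators on the
   right are [D b] and [D (f ^+ l)], of order at most [n]. *)
have -> : commutator d' (loc_mk f b l) = (fun x =>
     D b (loc_mk f 1 l * x) -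
       b%:F * (loc_mk f 1 l * (D (f ^+ l) (loc_mk f 1 l * x)))).
  apply/funext => x; have := d'C b (loc_mk f 1 l * x).
  have := d'C (f ^+ l) (loc_mk f 1 l * x).
  rewrite /commutator !mulrA [(f ^+ l)%:F * loc_mk f 1 l]mulrC loc_mk1V mul1r.
  move=> <- <-; rewrite (loc_mkE b) mulrBr.
  rewrite [_ * (to_loc f (f ^+ l) * _)]mulrA -[_ * to_loc f (f ^+ l)]mulrA.
  by rewrite loc_mk1V mulr1; ring.
have mulD e a : diffop_le kf n e -> diffop_le kf n (fun x => a * e x).
  by move=> de; apply: (diffop_le_comp (m := 0)) de => //; exact: diffop_le_mul.
have mulDr e a : diffop_le kf n e -> diffop_le kf n (fun x => e (a * x)).
  move=> de; apply: (diffop_le_comp (n := 0)) de _; first by rewrite addn0.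
  exact: diffop_le_mul.
have Dle r : diffop_le kf n (D r) by case: (DP r).
apply: diffop_leB; first exact: mulDr.
by apply: (mulD (fun x => _)); apply: (mulD (fun x => _)); apply: mulDr.
Qed.

End ExtensionToLocalization.

(** * Extending functional equations from nat to int *)

Section PolynomialFunctions.
Variable A : comPzRingType.
Implicit Types (phi psi : int -> A) (m : nat).

(** Degree below [m] is measured by the vanishing of the [m]-th finite difference, without choosing
    a polynomial that represents [phi]. *)
Fixpoint polyfun_lt m phi : Prop :=
  if m is m'.+1 then polyfun_lt m' (fun n => phi (n + 1) - phi n)
  else forall n, phi n = 0.

Definition polyfun phi : Prop := exists m, polyfun_lt m phi.

Lemma polyfun_lt_ext m phi psi :
  phi =1 psi -> polyfun_lt m phi -> polyfun_lt m psi.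
Proof. by move=> /funext ->. Qed.

Lemma polyfun_ltS m phi : polyfun_lt m phi -> polyfun_lt m.+1 phi.
Proof.
elim: m phi => [|m IHm] phi /=; last exact: IHm.
by move=> phi0 n; rewrite !phi0 subrr.
Qed.

Lemma polyfun_lt_leq m p phi :
  (m <= p)%N -> polyfun_lt m phi -> polyfun_lt p phi.
Proof.
by move=> /subnK <- ?; elim: (p - m)%N => // q IHq; exact: polyfun_ltS.
Qed.

Lemma polyfun_ltD m phi psi : polyfun_lt m phi -> polyfun_lt m psi ->
  polyfun_lt m (fun n => phi n + psi n).
Proof.
elim: m phi psi => [|m IHm] phi psi /=.
  by move=> h g n; rewrite h g addr0.
by move=> h g; apply: polyfun_lt_ext (IHm _ _ h g) => n; ring.
Qed.

Lemma polyfun_lt_shift m phi :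
  polyfun_lt m phi -> polyfun_lt m (fun n => phi (n + 1)).
Proof.
elim: m phi => [|m IHm] phi /=; first by move=> h n; rewrite h.
exact: IHm.
Qed.

Lemma polyfun_ltZ m c phi :
  polyfun_lt m phi -> polyfun_lt m (fun n => c * phi n).
Proof.
elim: m phi => [|m IHm] phi /=; first by move=> h n; rewrite h mulr0.
by move=> h; apply: polyfun_lt_ext (IHm _ h) => n; rewrite mulrBr.
Qed.

(** Discrete Leibniz rule: the difference of [n phi(n)] is [n] times the difference of [phi], plus
    [phi(n + 1)]. *)
Lemma polyfun_ltMint m phi :
  polyfun_lt m phi -> polyfun_lt m.+1 (fun n => n%:~R * phi n).
Proof.
elim: m phi => [|m IHm] phi h; first by move=> n; rewrite !h !mulr0 subrr.
change (polyfun_lt m.+1 (fun n => (n + 1)%:~R * phi (n + 1) - n%:~R * phi n)).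
have := polyfun_ltD (IHm _ h) (polyfun_lt_shift h); apply: polyfun_lt_ext => n.
by rewrite intrD; ring.
Qed.

(** By induction the difference vanishes on all of [int], so [phi] is constant and its value at 0
    carries over to the negative integers. *)
Lemma polyfun_lt_nat0 m phi :
  polyfun_lt m phi -> (forall n : nat, phi n%:Z = 0) ->
  forall n, phi n = 0.
Proof.
elim: m phi => [|m IHm] phi //= h phi0.
have phiS n : phi (n + 1) = phi n.
  apply/eqP; rewrite -subr_eq0; apply/eqP; move: n; apply: (IHm _ h) => n.
  by rewrite (_ : n%:Z + 1 = n.+1%:Z) ?phi0 ?subrr // -addn1 PoszD.
case=> [n|n]; first exact: phi0.
elim: n => [|n IHn]; first by rewrite -phiS (phi0 0%N).
by rewrite -phiS (_ : _ + 1 = Negz n) // !NegzE; ring.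
Qed.

Lemma eq_polyfun phi psi : phi =1 psi -> polyfun phi -> polyfun psi.
Proof. by move=> /funext ->. Qed.

Lemma polyfunD phi psi :
  polyfun phi -> polyfun psi -> polyfun (fun n => phi n + psi n).
Proof.
move=> [m h] [p g]; exists (maxn m p); apply: polyfun_ltD.
  by apply: polyfun_lt_leq h; rewrite leq_maxl.
by apply: polyfun_lt_leq g; rewrite leq_maxr.
Qed.

Lemma polyfunZ c phi : polyfun phi -> polyfun (fun n => c * phi n).
Proof. by case=> m h; exists m; exact: polyfun_ltZ. Qed.

Lemma polyfun_cst c : polyfun (fun=> c).
Proof. by exists 1%N => n /=; rewrite subrr. Qed.

Lemma polyfunMX phi i : polyfun phi -> polyfun (fun n => n%:~R ^+ i * phi n).
Proof.
move=> h; elim: i => [|i [m IHi]].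
  by apply: eq_polyfun h => n; rewrite expr0 mul1r.
exists m.+1; apply: polyfun_lt_ext (polyfun_ltMint IHi) => n.
by rewrite exprS mulrA.
Qed.

Lemma polyfun_sum I (r : seq I) (F : I -> int -> A) :
  (forall i, polyfun (F i)) -> polyfun (fun n => \sum_(i <- r) F i n).
Proof.
move=> h; elim: r => [|i r IHr].
  by apply: eq_polyfun (polyfun_cst 0) => n; rewrite big_nil.
by apply: eq_polyfun (polyfunD (h i) IHr) => n; rewrite big_cons.
Qed.

Lemma polyfun_nat0 phi : polyfun phi -> (forall n : nat, phi n%:Z = 0) ->
  forall n, phi n = 0.
Proof. by case=> m; exact: polyfun_lt_nat0. Qed.

End PolynomialFunctions.

Section MulopMorphism.
Variables (K : fieldType) (R : comAlgType K).

Lemma mulopE (a x : R) : mulop a x = a * x. Proof. by []. Qed.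

Let mulop_nmod : nmod_morphism (@mulop K R).
Proof.
split=> // a b; apply: diffop_eqP => x.
by rewrite diffopDE !mulopE mulrDl.
Qed.

Let mulop_monoid : monoid_morphism (@mulop K R).
Proof.
by split=> // a b; apply: diffop_eqP => x; rewrite diffopME !mulopE mulrA.
Qed.

HB.instance Definition _ := GRing.isNmodMorphism.Build
  R (diffop R) (@mulop K R) mulop_nmod.
HB.instance Definition _ := GRing.isMonoidMorphism.Build
  R (diffop R) (@mulop K R) mulop_monoid.

Lemma diffop_sumE I (r : seq I) (P : pred I) (F : I -> diffop R) x :
  (\sum_(i <- r | P i) F i) x = \sum_(i <- r | P i) F i x.
Proof.
apply: (big_morph (fun d : diffop R => d x)) => [d e|]; first exact: diffopDE.
exact: diffop0E.
Qed.

Lemma diffop_linear (d : diffop R) : Klinear (in_alg R) d.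
Proof. exact: is_diffop_lin (diffopP d). Qed.

Lemma horner_diffop_int (p : {poly diffop R}) (n : int) :
  p.[n%:~R] = \sum_(i < size p) p`_i * mulop (n%:~R ^+ i).
Proof.
by rewrite horner_coef; apply: eq_bigr => i _; rewrite rmorphXn rmorph_int.
Qed.

End MulopMorphism.

(** * Extended operators and integer powers of [f] *)

Section ExtensionOperator.
Variables (K : fieldType) (R : comAlgType K) (f : R).
Local Notation Rf := (localization f).
Local Notation kf := (K_to_loc f).

Lemma extends_to_loc_exists (d : diffop R) :
  exists d' : Rf -> Rf, extends_to_loc d d'.
Proof.
have [n /(diffop_le_extends f)[d' d'P d'E]] := diffopP d.
by exists d'; split=> //; exists n.
Qed.

Definition ext_loc (d : diffop R) : Rf -> Rf :=
  projT1 (cid (extends_to_loc_exists d)).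

Lemma ext_locP d : extends_to_loc d (ext_loc d).
Proof. by rewrite /ext_loc; case: cid. Qed.

Lemma ext_loc_diffop d : is_diffop kf (ext_loc d).
Proof. by case: (ext_locP d). Qed.

Lemma ext_locE d r : ext_loc d (to_loc f r) = to_loc f (d r).
Proof. by case: (ext_locP d). Qed.

(** Makes the choice in [ext_loc] canonical; additivity and multiplicativity below follow because
    both sides extend the same operator. *)
Lemma ext_loc_unique d d' : extends_to_loc d d' -> d' =1 ext_loc d.
Proof.
move=> [dd dE]; apply: diffop_loc_unique dd (ext_loc_diffop d) _ => r.
by rewrite dE ext_locE.
Qed.

Lemma ext_locD d e x : ext_loc (d + e) x = ext_loc d x + ext_loc e x.
Proof.
apply/esym/(@ext_loc_unique _ (fun x => ext_loc d x + ext_loc e x)).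
split; first by apply: is_diffopD; exact: ext_loc_diffop.
by move=> r; rewrite !ext_locE diffopDE rmorphD.
Qed.

Lemma ext_loc0 x : ext_loc 0 x = 0.
Proof.
apply/esym/(@ext_loc_unique _ (fun=> 0)).
split; first by exists 0%N; exact: diffop_le0.
by move=> r; rewrite diffop0E rmorph0.
Qed.

Lemma ext_loc_mulop a x : ext_loc (mulop a) x = to_loc f a * x.
Proof.
apply/esym/(@ext_loc_unique _ (fun x => _ * x)).
by split; [exact: is_diffop_mul | move=> r; rewrite -rmorphM].
Qed.

Lemma ext_locM d e x : ext_loc (d * e) x = ext_loc d (ext_loc e x).
Proof.
apply/esym/(@ext_loc_unique _ (fun x => ext_loc d (ext_loc e x))).
split; first by apply: is_diffop_comp; exact: ext_loc_diffop.
by move=> r; rewrite !ext_locE.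
Qed.

Lemma ext_loc_sum I (r : seq I) (P : pred I) (F : I -> diffop R) x :
  ext_loc (\sum_(i <- r | P i) F i) x = \sum_(i <- r | P i) ext_loc (F i) x.
Proof.
apply: (big_morph (fun d => ext_loc d x)) => [d e|]; first exact: ext_locD.
exact: ext_loc0.
Qed.

Lemma loc_powS (n : int) : loc_pow f (n + 1) = to_loc f f * loc_pow f n.
Proof.
case: n => [n|[|n]].
- by rewrite -PoszD addn1 /= exprS rmorphM.
- by rewrite (_ : Negz 0 + 1 = 0) //= mulrC loc_mk1V.
rewrite (_ : Negz n.+1 + 1 = Negz n); last by rewrite !NegzE; ring.
rewrite /= loc_mkM; apply/loc_mk_eqP; exists 0%N.
by rewrite mul1r (mulr1 f) (exprS f n.+1).
Qed.

Lemma loc_pow_addn (n : int) m :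
  loc_pow f (n + m%:Z) = to_loc f (f ^+ m) * loc_pow f n.
Proof.
elim: m => [|m IHm]; first by rewrite addr0 rmorph1 mul1r.
by rewrite -[in LHS]addn1 PoszD addrA loc_powS IHm exprS rmorphM mulrA.
Qed.

Lemma loc_powNK n : loc_pow f (- n) * loc_pow f n = 1.
Proof.
case: n => [[|n]|n]; first by rewrite /= mulr1.
  by rewrite -NegzE loc_mk1V.
by rewrite NegzE opprK mulrC -NegzE loc_mk1V.
Qed.

Lemma loc_powNS n : loc_pow f (- (n + 1)) * to_loc f f = loc_pow f (- n).
Proof. by rewrite mulrC -loc_powS opprD subrK. Qed.

(* The finite difference of n |-> f^-n d'(f^n) is f^-1 times the same function
   for [d', f], which has smaller order. *)
Lemma diffop_pow_polyfun (d' : Rf -> Rf) : is_diffop kf d' ->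
  polyfun (fun n => loc_pow f (- n) * d' (loc_pow f n)).
Proof.
case=> m dd; exists m.+1; elim: m d' dd => [|m IHm] d'.
  by case=> a -> n; rewrite !mulrA ![_ * a]mulrC -!mulrA !loc_powNK subrr.
move=> [_ /(_ (to_loc f f))/IHm dC].
change (polyfun_lt m.+1 (fun n => loc_pow f (- (n + 1)) * d' (loc_pow f (n + 1))
                        - loc_pow f (- n) * d' (loc_pow f n))).
apply: polyfun_lt_ext (polyfun_ltZ (loc_mk f 1 1) dC) => n.
rewrite /commutator -loc_powS -loc_powNS.
move: (loc_pow f (- (n + 1))) => L.
have VLF : loc_mk f 1 1 * (L * to_loc f f) = L.
  by have := loc_mk1V f 1; rewrite expr1 mulrCA => ->; rewrite mulr1.
by rewrite mulrA VLF mulrBr mulrA.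
Qed.

Lemma horner_int_polyfun (w : {poly R}) :
  polyfun (fun n : int => to_loc f w.[n%:~R]).
Proof.
apply: eq_polyfun (polyfun_sum (F := fun (i : 'I_(size w)) n =>
   n%:~R ^+ i * to_loc f w`_i) _ _) => [n|i].
  rewrite horner_coef rmorph_sum; apply: eq_bigr => i _.
  by rewrite rmorphM rmorphXn rmorph_int mulrC.
exact/polyfunMX/polyfun_cst.
Qed.

Lemma ext_loc_horner_int (p : {poly diffop R}) (n : int) x :
  ext_loc p.[n%:~R] x = \sum_(i < size p) n%:~R ^+ i * ext_loc p`_i x.
Proof.
rewrite horner_diffop_int ext_loc_sum; apply: eq_bigr => i _.
rewrite ext_locM ext_loc_mulop rmorphXn rmorph_int.
exact: Klinear_intX (is_diffop_lin (ext_loc_diffop p`_i)).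
Qed.

(* Both sides, divided by f^n, are polynomial functions of n. *)
Lemma nat_to_int_functional_eqn (g : {poly diffop R}) (w : {poly R}) m :
  (forall n : nat, g.[n%:R] (f ^+ (n + m)) = w.[n%:R] * f ^+ n) ->
  forall n : int, ext_loc g.[n%:~R] (loc_pow f (n + m%:Z))
                  = to_loc f w.[n%:~R] * loc_pow f n.
Proof.
move=> gw n; pose phi n :=
  loc_pow f (- n) * ext_loc g.[n%:~R] (loc_pow f (n + m%:Z))
  - to_loc f w.[n%:~R].
suff : phi n = 0.
  move/eqP; rewrite /phi subr_eq0 => /eqP <-.
  by rewrite mulrAC loc_powNK mul1r.
apply: polyfun_nat0 => {n} [|n]; last first.
  rewrite /phi -PoszD /= ext_locE gw rmorphM /= mulrCA.
  by rewrite (loc_powNK n%:Z) mulr1 subrr.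
apply: polyfunD; last first.
  apply: eq_polyfun (polyfunZ (-1) (horner_int_polyfun w)) => n.
  by rewrite mulN1r.
(* The factor [f^m] of [f^(n+m)] is absorbed into the coefficients, which leaves operators applied
   to [f^n] alone. *)
pose d i := ext_loc (g`_i * mulop (f ^+ m)).
apply: eq_polyfun (polyfun_sum (index_enum _) (F := fun (i : 'I_(size g)) n =>
   n%:~R ^+ i * (loc_pow f (- n) * d i (loc_pow f n))) _) => [n|i].
  rewrite ext_loc_horner_int mulr_sumr; apply: eq_bigr => i _.
  by rewrite /d ext_locM ext_loc_mulop loc_pow_addn mulrCA.
by apply/polyfunMX/diffop_pow_polyfun; exact: ext_loc_diffop.
Qed.

End ExtensionOperator.

Arguments ext_loc {K R} f d x.

(** * Ideals of functional equations *)

Section PolynomialIdeals.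
Variable K : fieldType.
Implicit Types (I : {poly K} -> Prop) (b p q : {poly K}).

Definition poly_ideal I : Prop :=
  I 0 /\ forall q a b, I a -> I b -> I (q * a + b).

(** The remainder of [b] modulo [p] lies in [I]; if nonzero, its monic multiple would be shorter
    than [p]. *)
Lemma poly_ideal_min_dvdp I p : poly_ideal I -> p \is monic -> I p ->
  (forall b, b \is monic -> I b -> (size p <= size b)%N) ->
  forall b, I b <-> p %| b.
Proof.
move=> [I0 IL] pm Ip pmin b.
have IZ q a : I a -> I (q * a) by move=> Ia; rewrite -[_ * _]addr0; exact: IL.
split=> [Ib|/dvdpP[q ->]]; last exact: IZ.
have Ir : I (b %% p).
  have -> : b %% p = - (b %/ p) * p + b.
    by rewrite {3}(divp_eq b p) mulNr addKr.
  exact: IL.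
apply/modp_eq0P/eqP/negP => /negP r0.
have lr0 : lead_coef (b %% p) != 0 by rewrite lead_coef_eq0.
have := pmin (((lead_coef (b %% p))^-1)%:P * (b %% p)).
rewrite monicE lead_coefM lead_coefC mulVf // eqxx => /(_ isT (IZ _ _ Ir)).
by rewrite mul_polyC size_scale ?invr_eq0 // leqNgt ltn_modp monic_neq0.
Qed.

Lemma poly_ideal_monic_gen I : poly_ideal I -> (exists2 b, b != 0 & I b) ->
  exists p, [/\ p \is monic, I p &
    forall b, b \is monic -> I b -> (size p <= size b)%N].
Proof.
move=> [I0 IL] [b b0 Ib].
have ex : exists n, `[< exists p, [/\ p \is monic, I p & size p = n] >].
  have lb0 : lead_coef b != 0 by rewrite lead_coef_eq0.
  exists (size b); apply/asboolP; exists ((lead_coef b)^-1 *: b); split.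
  - by rewrite monicE lead_coefZ mulVf.
  - by rewrite -mul_polyC -[_ * _]addr0; exact: IL.
  - by rewrite size_scale ?invr_eq0.
case: (ex_minnP ex) => n /asboolP[p [pm Ip <-]] nmin.
exists p; split=> // c cm Ic; apply: nmin; apply/asboolP.
by exists c.
Qed.

Lemma poly_ideal_gen I : poly_ideal I ->
  exists p, (p \is monic \/ p = 0) /\ forall b, I b <-> p %| b.
Proof.
move=> II; case: (pselect (exists2 b, b != 0 & I b)) => [ex|nex].
  have [p [pm Ip pmin]] := poly_ideal_monic_gen II ex.
  by exists p; split; [left | exact: poly_ideal_min_dvdp].
exists 0; split=> [|b]; first by right.
rewrite dvd0p; split=> [Ib|/eqP ->]; last by case: II.
by apply/negP => /negP b0; apply: nex; exists b.
Qed.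

End PolynomialIdeals.

Section FunctionalEquations.
Variables (K : fieldType) (R : comAlgType K) (f : R).
Implicit Types b : {poly K}.

Definition scalar_op : {rmorphism K -> diffop R} := @mulop K R \o in_alg R.

(** The coefficients do not commute, but an integer is central in [diffop R], which makes evaluation
    there multiplicative. *)
Lemma hornerM_int (p q : {poly diffop R}) (n : int) :
  (p * q).[n%:~R] = p.[n%:~R] * q.[n%:~R].
Proof. by rewrite hornerM_comm // /comm_poly; exact: esym (commr_int _ _). Qed.

Lemma horner_scalar_op b (n : int) :
  (map_poly scalar_op b).[n%:~R] = mulop (b.[n%:~R])%:A.
Proof. by rewrite -[n%:~R in LHS](rmorph_int scalar_op) horner_map. Qed.

Lemma BS_eqnP b : BS_eqn f b <-> exists g : {poly diffop R}, forall n : int,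
  ext_loc f g.[n%:~R] (loc_pow f (n + 1)) = K_to_loc f b.[n%:~R] * loc_pow f n.
Proof.
split=> -[g gb]; exists g => n.
  by have [d' /ext_loc_unique <-] := gb n.
by exists (ext_loc f g.[n%:~R]); [exact: ext_locP | exact: gb].
Qed.

Lemma BS_eqn_ideal : poly_ideal (BS_eqn f).
Proof.
split=> [|q a b /BS_eqnP[g ga] /BS_eqnP[h hb]]; apply/BS_eqnP.
  by exists 0 => n; rewrite !horner0 ext_loc0 rmorph0 mul0r.
exists (map_poly scalar_op q * g + h) => n.
rewrite hornerD hornerM_int horner_scalar_op ext_locD ext_locM ext_loc_mulop.
by rewrite ga hb hornerD hornerM rmorphD rmorphM mulrDl mulrA.
Qed.

Lemma sandwich_eqn_ideal : poly_ideal (sandwich_eqn f).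
Proof.
split=> [|q a b [s sa] [t tb]].
  by exists [::] => n; rewrite big_nil horner0 scale0r rmorph0.
exists ([seq (map_poly scalar_op q * p.1, p.2) | p <- s] ++ t) => n.
rewrite big_cat big_map /= tb hornerD scalerDl rmorphD; congr (_ + _).
rewrite hornerM -scalerA -mulr_algl (rmorphM (@mulop K R)) /= -sa mulr_sumr.
apply: eq_bigr => p _.
by rewrite (hornerM_int _ _ n) (horner_scalar_op _ n) !mulrA.
Qed.

Lemma is_BS_polyP b :
  is_BS_poly f b <-> b \is monic /\ forall c, BS_eqn f c <-> b %| c.
Proof.
split=> [[bm fb bmin]|[bm bE]].
  by split=> //; apply: poly_ideal_min_dvdp bmin => //; exact: BS_eqn_ideal.
split=> // [|c cm /bE /dvdp_leq -> //]; first exact/bE.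
exact: monic_neq0.
Qed.

(** Evaluation at [u]: as [beta(n) u = u h(n)], multiplication by [h(n)] can be composed with
    [alpha(n)], giving a single operator applied to [u f^(n+1)]. It serves with [u = 1] in general
    and with [u = x] on the node. *)
Lemma sandwich_eqn_eval (u : R) b :
  (forall d : diffop R, exists h, d u = u * h) -> sandwich_eqn f b ->
  exists g : {poly diffop R}, forall n : nat,
    g.[n%:R] (u * f ^+ n.+1) = b.[n%:R] *: (u * f ^+ n).
Proof.
move=> /choice[h hE] [s sb].
pose H (p : {poly diffop R}) : {poly diffop R} :=
  \poly_(i < size p) mulop (h p`_i).
have HE p (n : nat) x : (H p).[n%:R] (u * x) = x * p.[n%:R] u.
  rewrite horner_poly (horner_diffop_int p n) !diffop_sumE mulr_sumr.
  apply: eq_bigr => i _; rewrite !diffopME -(rmorph_nat (@mulop K R)) -rmorphXn.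
  rewrite !mulopE (Klinear_intX _ _ _ (diffop_linear _)) hE.
  by rewrite mulrCA [RHS]mulrCA; congr (_ * _); ring.
exists (\sum_(p <- s) p.1 * H p.2) => n.
rewrite horner_sum diffop_sumE.
have := congr1 (fun d : diffop R => d u) (sb n).
rewrite /= diffop_sumE => e.
rewrite [u * f ^+ n]mulrC scalerAl -e; apply: eq_bigr => p _.
by rewrite (hornerM_int _ _ n) !diffopME HE.
Qed.

Lemma sandwich_eqn_BS b : sandwich_eqn f b -> BS_eqn f b.
Proof.
move=> /(@sandwich_eqn_eval 1)[d|g gb]; first by exists (d 1); rewrite mul1r.
apply/BS_eqnP; exists g => n.
rewrite (@nat_to_int_functional_eqn _ _ _ _ (map_poly (in_alg R) b) 1) => [|m].
  by rewrite -[n%:~R in LHS](rmorph_int (in_alg R)) horner_map.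
rewrite addn1 -[f ^+ _]mul1r gb mul1r.
by rewrite -[m%:R in RHS](rmorph_nat (in_alg R)) horner_map mulr_algl.
Qed.

Lemma BS_poly_of_sandwich : (exists2 b, b != 0 & sandwich_eqn f b) ->
  exists b c, [/\ is_BS_poly f b, is_sandwich_BS_poly f c & b %| c].
Proof.
case=> b0 b0n0 sb0.
have [b bP] : exists b, is_BS_poly f b.
  apply: poly_ideal_monic_gen BS_eqn_ideal _.
  by exists b0 => //; exact: sandwich_eqn_BS.
have [c [cm cP]] := poly_ideal_gen sandwich_eqn_ideal.
exists b, c; split=> //.
(* The generator [c] satisfies its own sandwich equation, hence a Bernstein-Sato equation, also when
   [c = 0]. *)
by have [_ <-] := proj1 (is_BS_polyP b) bP; apply: sandwich_eqn_BS; apply/cP.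
Qed.

End FunctionalEquations.

(** * Smooth algebras *)

Section StrictOrder.
Variables (K : fieldType) (A : comPzRingType) (k : {rmorphism K -> A}).
Implicit Types (d e : A -> A) (m : nat).

(** The index is shifted so that level 0 is the zero operator and level 1 the multiplications; a
    commutator then drops a level at every stage, including the last. *)
Definition order_lt m d : Prop :=
  if m is n.+1 then diffop_le k n d else forall x, d x = 0.

Lemma order_ltSP m d : order_lt m.+1 d <->
  Klinear k d /\ forall r, order_lt m (commutator d r).
Proof.
case: m => [|m] //; split=> [dd|[dL d0]].
  split; first exact: (diffop_le_lin (n := 0)).
  by case: dd => a -> r x; rewrite commutator_mul.
exists (d 1); apply/funext => x; have /eqP := d0 x 1.
by rewrite /commutator mulr1 subr_eq0 mulrC => /eqP.
Qed.

Lemma order_lt_ext m d e : d =1 e -> order_lt m d -> order_lt m e.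
Proof. by move=> /funext ->. Qed.

Lemma order_lt0 m : order_lt m (fun=> 0).
Proof. by case: m => // m; exact: diffop_le0. Qed.

Lemma order_ltD m d e : order_lt m d -> order_lt m e ->
  order_lt m (fun x => d x + e x).
Proof.
case: m => [|m] /=; last exact: diffop_leD.
by move=> h g x; rewrite h g addr0.
Qed.

Lemma order_lt_sum m I (r : seq I) (F : I -> A -> A) :
  (forall i, order_lt m (F i)) -> order_lt m (fun x => \sum_(i <- r) F i x).
Proof.
move=> h; elim: r => [|i r IHr].
  by apply: order_lt_ext (order_lt0 m) => x; rewrite big_nil.
by apply: order_lt_ext (order_ltD (h i) IHr) => x; rewrite big_cons.
Qed.

Lemma order_lt_mull m a d : order_lt m d -> order_lt m (fun x => a * d x).
Proof.
case: m => [|m] /= h; first by move=> x; rewrite h mulr0.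
by apply: (diffop_le_comp (m := 0)) h => //; exact: diffop_le_mul.
Qed.

Lemma order_lt_mulr m a d : order_lt m d -> order_lt m (fun x => d (a * x)).
Proof.
case: m => [|m] /= h; first by move=> x; rewrite h.
apply: (diffop_le_comp (n := 0)) h _; first by rewrite addn0.
exact: diffop_le_mul.
Qed.

Lemma order_lt_commutator m d r :
  order_lt m.+1 d -> order_lt m (commutator d r).
Proof. by case/order_ltSP. Qed.

Lemma is_diffop_sum I (r : seq I) (F : I -> A -> A) :
  (forall i, is_diffop k (F i)) -> is_diffop k (fun x => \sum_(i <- r) F i x).
Proof.
move=> h; elim: r => [|i r IHr].
  by exists 0%N, 0; apply/funext => x; rewrite big_nil mul0r.
rewrite (_ : (fun x => _) = (fun x => F i x + \sum_(i <- r) F i x)).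
  exact: is_diffopD.
by apply/funext => x; rewrite big_cons.
Qed.

Lemma commutatorC d r s x :
  commutator (commutator d r) s x = commutator (commutator d s) r x.
Proof. by rewrite /commutator mulrCA; ring. Qed.

End StrictOrder.

(** * The trivial extension of [R] by the square-zero ideal [R^n] *)

Section SquareZeroExtension.
Variables (K : fieldType) (R : comAlgType K) (n : nat).

Definition sqzero : Type := (R * 'rV[R]_n)%type.

HB.instance Definition _ := GRing.Zmodule.on sqzero.

Let mul (v w : sqzero) : sqzero := (v.1 * w.1, v.1 *: w.2 + w.1 *: v.2).

Let mulA : associative mul.
Proof.
move=> u v w; congr (_, _); first exact: mulrA.
by apply/rowP => i; rewrite /= !mxE; ring.
Qed.

Let mulC : commutative mul.
Proof.
by move=> u v; congr (_, _); [exact: mulrC | rewrite addrC].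
Qed.

Let mul1 : left_id ((1, 0) : sqzero) mul.
Proof.
by move=> [r v]; congr (_, _); rewrite /= ?mul1r // scaler0 addr0 scale1r.
Qed.

Let mulD : left_distributive mul +%R.
Proof.
move=> u v w; congr (_, _); first exact: mulrDl.
by apply/rowP => i; rewrite /= !mxE; ring.
Qed.

Let one_neq0 : ((1, 0) : sqzero) != 0.
Proof. by apply/eqP => -[/eqP]; rewrite oner_eq0. Qed.

HB.instance Definition _ := GRing.Zmodule_isComNzRing.Build sqzero
  mulA mulC mul1 mulD one_neq0.

Let scale (c : K) (v : sqzero) : sqzero := (c *: v.1, c%:A *: v.2).

Let scaleA a b v : scale a (scale b v) = scale (a * b) v.
Proof.
congr (_, _); first exact: scalerA.
by rewrite scalerA -(rmorphM (in_alg R)).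
Qed.

Let scale1 : left_id 1 scale.
Proof. by move=> [r v]; congr (_, _); rewrite /= !scale1r. Qed.

Let scaleDr : right_distributive scale +%R.
Proof. by move=> a u v; congr (_, _); rewrite /= scalerDr. Qed.

Let scaleDl v : {morph scale^~ v : a b / a + b}.
Proof. by move=> a b; congr (_, _); rewrite /= !scalerDl. Qed.

HB.instance Definition _ := GRing.Zmodule_isLmodule.Build K sqzero
  scaleA scale1 scaleDr scaleDl.

Let scaleAl (a : K) (u v : sqzero) : a *: (u * v) = (a *: u) * v.
Proof.
congr (_, _); first exact: scalerAl.
by apply/rowP => i; rewrite /= !mxE -[a *: u.1]mulr_algl; ring.
Qed.

HB.instance Definition _ := GRing.Lmodule_isLalgebra.Build K sqzero scaleAl.
HB.instance Definition _ := GRing.Lalgebra_isComAlgebra.Build K sqzero.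

End SquareZeroExtension.

(** * Coordinates for first-order symbols *)

Section SymbolCoordinates.
Variables (K : fieldType) (R : comAlgType K) (n : nat) (x : 'I_n -> R).
Local Notation order_lt := (order_lt (in_alg R)).

(* The first-order symbol identity [d, r] = \sum_i v_i [d, x_i] modulo
   operators of order two less than d. *)
Definition symbol_coord (w : sqzero R n) : Prop :=
  forall m d, order_lt m.+2 d ->
    order_lt m (fun y => commutator d w.1 y
                         - \sum_i commutator d (x i) (w.2 0 i * y)).

Lemma symbol_coordD v w :
  symbol_coord v -> symbol_coord w -> symbol_coord (v + w).
Proof.
move=> hv hw m d dd; have [dL _] := (proj1 (order_ltSP _ _ _)) dd.
apply: order_lt_ext (order_ltD (hv _ _ dd) (hw _ _ dd)) => y.
rewrite addrACA -opprD -big_split /=; congr (_ - _).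
  by rewrite /commutator !mulrDl (proj1 dL) opprD addrACA.
apply: eq_bigr => i _; rewrite mxE mulrDl.
by rewrite /commutator !mulrDr !(proj1 dL) mulrDr opprD addrACA.
Qed.

(** Since [[d, r s] = [d, r] s + r [d, s]] as operators, the only new error comes from moving [v.1]
    past [[d, x_i]]; it is a double commutator, two levels below [d]. *)
Lemma symbol_coordM v w :
  symbol_coord v -> symbol_coord w -> symbol_coord (v * w).
Proof.
move=> hv hw m d dd; have [dL _] := (proj1 (order_ltSP _ _ _)) dd.
have hC : order_lt m (fun y => - \sum_i
    commutator (commutator d (x i)) v.1 (w.2 0 i * y)).
  pose F i y := commutator (commutator d (x i)) v.1 (w.2 0 i * y).
  have FS : order_lt m (fun y => \sum_i F i y).
    apply: order_lt_sum => i; apply: order_lt_mulr (commutator _ _) _.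
    by do 2!apply: order_lt_commutator.
  by apply: order_lt_ext (order_lt_mull (-1) FS) => y; rewrite mulN1r.
apply: order_lt_ext (order_ltD (order_ltD (order_lt_mulr w.1 (hv _ _ dd))
  (order_lt_mull v.1 (hw _ _ dd))) hC) => y.
rewrite [X in _ + X + _]mulrBr mulr_sumr [X in X + _]addrACA -[LHS]addrA.
rewrite -!opprD -!big_split /=; congr (_ - _).
  by rewrite /commutator -[v.1 * w.1 * y]mulrA; ring.
apply: eq_bigr => i _; rewrite !mxE mulrDl; set e := commutator d (x i).
have eD u t : e (u + t) = e u + e t.
  by rewrite /e /commutator mulrDr !(proj1 dL) mulrDr opprD addrACA.
rewrite eD /commutator -addrA subrKC addrC !mulrA.
by rewrite [w.1 * v.2 0 i]mulrC.
Qed.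

Lemma symbol_coord_scalar c : symbol_coord (c%:A).
Proof.
move=> m d dd; have [dL _] := (proj1 (order_ltSP _ _ _)) dd.
apply: order_lt_ext (order_lt0 _ m) => y.
rewrite big1 => [|i _]; first by rewrite /commutator (proj2 dL) subrr subr0.
by rewrite mxE mxE mulr0 mul0r /commutator mulr0 (Klinear0 dL) mulr0 subrr.
Qed.

Definition symbol_pred : {pred sqzero R n} := fun w => `[< symbol_coord w >].

Let symbol_pred_subalg : subalg_closed symbol_pred.
Proof.
split=> [|a u v|u v].
- by apply/asboolP; rewrite -[1]scale1r; exact: symbol_coord_scalar.
- move=> /asboolP hu /asboolP hv; apply/asboolP; rewrite -mulr_algl.
  apply: symbol_coordD hv; apply: symbol_coordM hu.
  exact: symbol_coord_scalar.
by move=> /asboolP hu /asboolP hv; apply/asboolP; exact: symbol_coordM.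
Qed.

HB.instance Definition _ := GRing.isSubalgClosed.Build K
  (sqzero R n) symbol_pred symbol_pred_subalg.

(** Lifting takes place into this subalgebra, not into all of [sqzero R n], so that any lift of the
    identity of [R] carries the symbol identity with it. *)
Definition symbol_alg : Type := {w : sqzero R n | symbol_pred w}.
HB.instance Definition _ := SubType.on symbol_alg.
HB.instance Definition _ := Choice.on symbol_alg.
HB.instance Definition _ := [SubChoice_isSubAlgebra of symbol_alg by <:].
HB.instance Definition _ := [SubNzRing_isSubComNzRing of symbol_alg by <:].
HB.instance Definition _ := GRing.Lalgebra_isComAlgebra.Build K symbol_alg.

Definition symbol_proj (w : symbol_alg) : R := (val w).1.

Let symbol_proj_zmod : zmod_morphism symbol_proj.
Proof. by move=> u v; rewrite /symbol_proj rmorphB. Qed.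

Let symbol_proj_monoid : monoid_morphism symbol_proj.
Proof. by split=> [|u v]; rewrite /symbol_proj ?rmorph1 ?rmorphM. Qed.

Let symbol_proj_scalable : scalable symbol_proj.
Proof. by move=> a u; rewrite /symbol_proj linearZ. Qed.

HB.instance Definition _ := GRing.isZmodMorphism.Build
  symbol_alg R symbol_proj symbol_proj_zmod.
HB.instance Definition _ := GRing.isMonoidMorphism.Build
  symbol_alg R symbol_proj symbol_proj_monoid.
HB.instance Definition _ := GRing.isScalable.Build K
  symbol_alg R *:%R symbol_proj symbol_proj_scalable.

Lemma symbol_coord_gen i : symbol_coord (x i, \row_j (j == i)%:R).
Proof.
move=> m d dd; have [dL _] := (proj1 (order_ltSP _ _ _)) dd.
apply: order_lt_ext (order_lt0 _ m) => y.
rewrite (bigD1 i) //= big1 => [|j ji].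
  by rewrite mxE eqxx mul1r addr0 subrr.
rewrite mxE (negPf ji) mul0r /commutator mulr0.
by rewrite (Klinear0 dL) mulr0 subrr.
Qed.

Let lift_gen i : symbol_alg :=
  exist (fun w => symbol_pred w) _ (asboolT (symbol_coord_gen i)).

Lemma symbol_proj_surj :
  (forall r, exists p, mpoly.mmap (in_alg R) x p = r) ->
  forall r, exists w, symbol_proj w = r.
Proof.
move=> gen r; have [p <-] := gen r.
exists (mpoly.mmap (in_alg symbol_alg) lift_gen p).
rewrite /mpoly.mmap rmorph_sum; apply: eq_bigr => m _.
rewrite rmorphM /= rmorph_alg /mpoly.mmap1 rmorph_prod; congr (_ * _).
by apply: eq_bigr => i _; rewrite rmorphXn.
Qed.

Lemma symbol_proj_ker u v : symbol_proj u = 0 -> symbol_proj v = 0 -> u * v = 0.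
Proof.
rewrite /symbol_proj => u0 v0; apply: val_inj; rewrite rmorphM rmorph0 /=.
by congr (_, _); rewrite u0 v0 ?mul0r // !scale0r addr0.
Qed.

End SymbolCoordinates.

(** Formal smoothness lifts the identity of [R] to [psi r = (r, (D_i r))]; multiplicativity of [psi]
    is the Leibniz rule, and membership in [symbol_alg x] is the symbol identity. *)
Lemma smooth_symbol_coord (K : fieldType) (R : comAlgType K) : smooth R ->
  exists n (x : 'I_n -> R) (D : 'I_n -> R -> R),
    (forall i, Klinear (in_alg R) (D i) /\
       forall r s, D i (r * s) = D i r * s + r * D i s) /\
    forall m d r, order_lt (in_alg R) m.+2 d ->
      order_lt (in_alg R) m (fun y => commutator d r y
                         - \sum_i commutator d (x i) (D i r * y)).
Proof.
move=> [[n [x [_ [_ [gen _]]]]] lift]; exists n, x.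
have [psi psiK] := lift (symbol_alg x) R (@symbol_proj _ _ _ x)
  (symbol_proj_surj gen) (@symbol_proj_ker _ _ _ x) idfun.
have psi1 r : (val (psi r)).1 = r by exact: psiK.
exists (fun i r => (val (psi r)).2 0 i); split=> [i|m d r dd].
  split; first split=> [r s|c r].
  - by rewrite !rmorphD mxE.
  - by rewrite !mulr_algl !linearZ mxE; exact: mulr_algl.
  move=> r s; rewrite !rmorphM mxE mxE mxE /= !psi1 addrC.
  by rewrite [s * _]mulrC.
by have := asboolW (valP (psi r)) m d dd; rewrite psi1.
Qed.

(** * Sandwich representations and generation by derivations *)

Section SmoothSandwich.
Variables (K : fieldType) (R : comAlgType K).
Local Notation k := (in_alg R).

(* Stable under composition and true for derivations, for which the operator of
   multiplication by d g is the commutator of d and g. *)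
Definition sandwiched (d : R -> R) : Prop :=
  exists s : seq (diffop R * diffop R),
    forall g y, d g * y = \sum_(p <- s) p.1 (g * p.2 y).

Lemma sandwiched_ext d e : d =1 e -> sandwiched d -> sandwiched e.
Proof. by move=> /funext ->. Qed.

Lemma sandwiched0 : sandwiched (fun=> 0).
Proof. by exists [::] => g y; rewrite big_nil mul0r. Qed.

Lemma sandwiched_mul a : sandwiched (fun x => a * x).
Proof. by exists [:: (mulop a, 1)] => g y; rewrite big_seq1 /= mul1r mulrA. Qed.

Lemma sandwichedD d e :
  sandwiched d -> sandwiched e -> sandwiched (fun x => d x + e x).
Proof.
move=> [s ds] [t et]; exists (s ++ t) => g y.
by rewrite mulrDl big_cat ds et.
Qed.

(** Expanding [d] first and [e] inside it composes the outer operators in the order of [d] and [e],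
    and the inner ones in the reverse order. *)
Lemma sandwiched_comp d e :
  sandwiched d -> sandwiched e -> sandwiched (fun x => d (e x)).
Proof.
move=> [s ds] [t et].
exists (allpairs (fun p q => (p.1 * q.1, q.2 * p.2)) s t) => g y.
rewrite big_allpairs_dep ds; apply: eq_bigr => p _.
rewrite et (Klinear_sum _ _ _ (diffop_linear p.1)).
by apply: eq_bigr.
Qed.

Lemma sandwiched_sum I (r : seq I) (F : I -> R -> R) :
  (forall i, sandwiched (F i)) -> sandwiched (fun x => \sum_(i <- r) F i x).
Proof.
move=> h; elim: r => [|i r IHr].
  by apply: sandwiched_ext sandwiched0 => x; rewrite big_nil.
by apply: sandwiched_ext (sandwichedD (h i) IHr) => x; rewrite big_cons.
Qed.

Section Derivation.
Variable D : R -> R.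
Hypothesis D_lin : Klinear k D.
Hypothesis D_leibniz : forall r s, D (r * s) = D r * s + r * D s.

Lemma derivation_commutator r x : commutator D r x = D r * x.
Proof. by rewrite /commutator D_leibniz addrK. Qed.

Lemma derivation_is_diffop : is_diffop k D.
Proof.
exists 1%N; split=> // r; exists (D r).
by apply/funext; exact: derivation_commutator.
Qed.

(** The Leibniz rule in the form [D(g) y = D(g y) - g D(y)]. *)
Lemma sandwiched_derivation : sandwiched D.
Proof.
pose d := Diffop derivation_is_diffop.
exists [:: (d, 1); (mulop (-1), d)] => g y.
by rewrite big_cons big_seq1 /= mul1r mulN1r D_leibniz addrK.
Qed.

End Derivation.

Section Generation.
Variables (n : nat) (x : 'I_n -> R) (D : 'I_n -> R -> R).
Hypothesis D_lin : forall i, Klinear k (D i).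
Hypothesis D_leibniz : forall i r s, D i (r * s) = D i r * s + r * D i s.
Hypothesis D_coord : forall m d r, order_lt k m.+2 d ->
  order_lt k m (fun y => commutator d r y
                         - \sum_i commutator d (x i) (D i r * y)).

(* Euler's identity for symbols. *)
Lemma euler_symbol m d : order_lt k m.+1 d ->
  order_lt k m (fun y => m%:R * d y - \sum_i commutator d (x i) (D i y)).
Proof.
elim: m d => [|m IHm] d dd.
  case: dd => a -> y; rewrite mul0r sub0r big1 ?oppr0 // => i _.
  by rewrite commutator_mul.
have [dL dC] := (proj1 (order_ltSP _ _ _)) dd.
have dOp : is_diffop k d by exists m.+1.
apply/order_ltSP; split=> [|r].
  apply: is_diffop_lin; apply: is_diffopB.
    by apply: is_diffop_comp dOp; exact: is_diffop_mul.
  apply: is_diffop_sum => i; apply: is_diffop_comp.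
    exact: is_diffop_commutator.
  exact: derivation_is_diffop.
(* The commutator of the Euler expression with [r] splits: induction on [[d, r]] accounts for [m
   [d, r]], and [D_coord] supplies the remaining copy. *)
apply: order_lt_ext (order_ltD (IHm _ (dC r)) (D_coord r dd)) => y.
rewrite addrACA -opprD -big_split /= /commutator.
have -> : \sum_i (commutator (commutator d r) (x i) (D i y)
      + commutator d (x i) (D i r * y))
  = \sum_i commutator d (x i) (D i (r * y))
    - r * \sum_i commutator d (x i) (D i y).
  rewrite mulr_sumr -sumrB; apply: eq_bigr => i _.
  rewrite D_leibniz commutatorC; set e := commutator d (x i).
  have -> : e (D i r * y + r * D i y) = e (D i r * y) + e (r * D i y).
    exact: (proj1 (is_diffop_lin (is_diffop_commutator (x i) dOp))).
  by rewrite [commutator e r _]/commutator; ring.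
by rewrite -natr1; ring.
Qed.

(** Induction on the order: Euler's identity makes a positive integer multiple of [d] the sum of an
    operator [E] of lower order and the composites [[d, x_i] D_i]; characteristic 0 allows division
    by that integer. *)
Lemma sandwiched_order_lt m d :
  [pchar K] =i pred0 -> order_lt k m d -> sandwiched d.
Proof.
move=> K0; elim: m d => [|m IHm] d dd.
  by apply: sandwiched_ext sandwiched0 => y; rewrite dd.
case: m IHm dd => [|m] IHm dd.
  by case: dd => a ->; exact: sandwiched_mul.
have m0 : m.+1%:R != 0 :> K by rewrite (proj1 (pcharf0P K) K0).
pose E y := m.+1%:R * d y - \sum_i commutator d (x i) (D i y).
have sE : sandwiched E by apply: IHm; exact: euler_symbol.
have sD : sandwiched (fun y => \sum_i commutator d (x i) (D i y)).
  apply: sandwiched_sum => i; apply: sandwiched_comp.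
    by apply: IHm; exact: order_lt_commutator.
  exact: sandwiched_derivation.
apply: sandwiched_ext (sandwiched_comp (sandwiched_mul (m.+1%:R^-1)%:A)
  (sandwichedD sE sD)) => y.
by rewrite /E subrK mulr_algl mulr_natl -scaler_nat scalerA mulVf // scale1r.
Qed.

End Generation.

Lemma smooth_sandwiched (d : diffop R) :
  [pchar K] =i pred0 -> smooth R -> sandwiched d.
Proof.
move=> K0 /smooth_symbol_coord[n [x [D [DP Dc]]]].
have [m dm] := diffopP d.
by apply: (@sandwiched_order_lt n x D _ _ Dc m.+1 d K0 dm) => i; case: (DP i).
Qed.

Lemma BS_eqn_sandwich (f : R) b : [pchar K] =i pred0 -> smooth R ->
  GRing.lreg f -> BS_eqn f b -> sandwich_eqn f b.
Proof.
move=> K0 sm fr /BS_eqnP[g gb].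
(* For natural [n] the equation descends from the localization to [R], since [f] is regular. *)
have {}gb (n : nat) : g.[n%:R] (f ^+ n.+1) = b.[n%:R] *: f ^+ n.
  have := gb n; rewrite -PoszD addn1 /= ext_locE -rmorphM /= mulr_algl.
  move/eqP; rewrite -subr_eq0 -rmorphB => /eqP/to_loc_eq0[t] /eqP.
  rewrite -[X in _ == X](mulr0 (f ^+ t)) (inj_eq (lregX fr)) subr_eq0.
  by move/eqP.
have /choice[s sE] i := smooth_sandwiched g`_i K0 sm.
(* Each coefficient of [g] is sandwiched separately around [f^(n+1)]; the power of the variable goes
   into the left factor, and the right factor is constant. *)
exists (flatten [seq [seq (p.1 *: 'X^i, p.2%:P) | p <- s i]
  | i <- index_iota 0 (size g)]).
move=> n; apply: diffop_eqP => y.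
rewrite big_flatten big_map diffop_sumE mulopE -gb.
rewrite (horner_diffop_int g n) diffop_sumE mulr_suml.
rewrite big_mkord; apply: eq_bigr => i _.
rewrite big_map diffop_sumE diffopME sE; apply: eq_bigr => p _.
rewrite /= hornerZ hornerXn hornerC.
by rewrite -(rmorph_nat (@mulop K R)) -rmorphXn diffopME mulopE mulrA.
Qed.

(** The two ideals of functional equations coincide. The condition [b != 0] excludes the value 0
    that a sandwich polynomial may take, while a Bernstein-Sato polynomial is monic. *)
Lemma is_BS_poly_sandwich (f : R) b : [pchar K] =i pred0 -> smooth R ->
  GRing.lreg f -> is_BS_poly f b <-> is_sandwich_BS_poly f b /\ b != 0.
Proof.
move=> K0 sm fr; have BSs c : BS_eqn f c <-> sandwich_eqn f c.
  by split; [exact: BS_eqn_sandwich | exact: sandwich_eqn_BS].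
split=> [/is_BS_polyP[bm bE]|[[bm bE] b0]].
  split; last exact: monic_neq0.
  by split=> [|c]; [left | rewrite -BSs].
apply/is_BS_polyP; split=> [|c]; last by rewrite BSs.
by case: bm => // b00; rewrite b00 eqxx in b0.
Qed.

End SmoothSandwich.

(** * The node *)

Section Node.
Variable K : fieldType.
Implicit Types p q : {poly K}.

Definition node_pred : {pred {poly K} * {poly K}} := fun w => w.1`_0 == w.2`_0.

Let node_pred_subalg : subalg_closed node_pred.
Proof.
split=> [|a u v /eqP hu /eqP hv|u v /eqP hu /eqP hv]; apply/eqP => //=.
  by rewrite !coefD !coefZ hu hv.
by rewrite !coef0M hu hv.
Qed.

HB.instance Definition _ := GRing.isSubalgClosed.Build K
  ({poly K} * {poly K})%type node_pred node_pred_subalg.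

(* K[x, y] / (x y), seen inside its normalization K[x] * K[y]. *)
Definition node : Type := {p : {poly K} * {poly K} | node_pred p}.
HB.instance Definition _ := SubType.on node.
HB.instance Definition _ := Choice.on node.
HB.instance Definition _ := [SubChoice_isSubAlgebra of node by <:].
HB.instance Definition _ := [SubNzRing_isSubComNzRing of node by <:].
HB.instance Definition _ := GRing.Lalgebra_isComAlgebra.Build K node.

Definition branch1 (x : node) : {poly K} := (val x).1.
Definition branch2 (x : node) : {poly K} := (val x).2.

Let branch1_zmod : zmod_morphism branch1.
Proof. by move=> x y; rewrite /branch1 rmorphB. Qed.
Let branch1_monoid : monoid_morphism branch1.
Proof. by split=> [|x y]; rewrite /branch1 ?rmorph1 ?rmorphM. Qed.
Let branch1_scalable : scalable branch1.
Proof. by move=> a x; rewrite /branch1 linearZ. Qed.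
HB.instance Definition _ :=
  GRing.isZmodMorphism.Build node {poly K} branch1 branch1_zmod.
HB.instance Definition _ :=
  GRing.isMonoidMorphism.Build node {poly K} branch1 branch1_monoid.
HB.instance Definition _ :=
  GRing.isScalable.Build K node {poly K} *:%R branch1 branch1_scalable.

Let branch2_zmod : zmod_morphism branch2.
Proof. by move=> x y; rewrite /branch2 rmorphB. Qed.
Let branch2_monoid : monoid_morphism branch2.
Proof. by split=> [|x y]; rewrite /branch2 ?rmorph1 ?rmorphM. Qed.
Let branch2_scalable : scalable branch2.
Proof. by move=> a x; rewrite /branch2 linearZ. Qed.
HB.instance Definition _ :=
  GRing.isZmodMorphism.Build node {poly K} branch2 branch2_zmod.
HB.instance Definition _ :=
  GRing.isMonoidMorphism.Build node {poly K} branch2 branch2_monoid.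
HB.instance Definition _ :=
  GRing.isScalable.Build K node {poly K} *:%R branch2 branch2_scalable.

Lemma node_inj (x y : node) :
  branch1 x = branch1 y -> branch2 x = branch2 y -> x = y.
Proof.
move=> h1 h2; apply: val_inj; rewrite /= [val x]surjective_pairing.
by rewrite [val y]surjective_pairing; congr (_, _).
Qed.

Lemma node_coef0 (x : node) : (branch1 x)`_0 = (branch2 x)`_0.
Proof. by apply/eqP; case: x. Qed.

Definition mk_node p q (pq : p`_0 = q`_0) : node :=
  exist (fun w => node_pred w) (p, q) (introT eqP pq).

Lemma branch1_mk p q pq : branch1 (@mk_node p q pq) = p. Proof. by []. Qed.
Lemma branch2_mk p q pq : branch2 (@mk_node p q pq) = q. Proof. by []. Qed.
Definition branchE := (branch1_mk, branch2_mk).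

Lemma coef0_XM p : ('X * p)`_0 = 0.
Proof. by rewrite coefXM. Qed.

(** The element [x + y], equal to the coordinate on each branch. *)
Definition node_f : node := mk_node (erefl ('X : {poly K})`_0).

Let x_coef0 : ('X : {poly K})`_0 = (0 : {poly K})`_0.
Proof. by rewrite coefX coef0. Qed.
Definition node_x : node := mk_node x_coef0.
Definition node_y : node := mk_node (esym x_coef0).

Lemma node_f_lreg : GRing.lreg node_f.
Proof.
have X0 : ('X : {poly K}) != 0 by rewrite polyX_eq0.
move=> a b ab; apply: node_inj; apply: (mulfI X0).
  by have := congr1 branch1 ab; rewrite !rmorphM.
by have := congr1 branch2 ab; rewrite !rmorphM.
Qed.

(* node_x is y-torsion, and differential operators preserve y-torsion. *)
Lemma diffop_node_x (d : diffop node) : exists h, d node_x = node_x * h.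
Proof.
have yx : node_y * node_x = 0.
  by apply: node_inj; rewrite rmorphM rmorph0 /= !branchE ?mul0r ?mulr0.
(* Localization at [y] kills [x], so the extended operator sends it to 0 and [d x] is
   [y]-torsion. *)
have [t ytd] : exists t, node_y ^+ t * d node_x = 0.
  apply: to_loc_eq0; rewrite -ext_locE (@exp_eq0_to_loc _ _ _ 1) ?expr1 //.
  exact: Klinear0 (is_diffop_lin (ext_loc_diffop node_y d)).
have d2 : branch2 (d node_x) = 0.
  have /eqP := congr1 branch2 ytd; rewrite rmorphM rmorphXn rmorph0 /= branchE.
  by rewrite mulf_eq0 expf_eq0 polyX_eq0 andbF => /eqP.
have [h h0] : exists h, branch1 (d node_x) = 'X * h.
  have : root (branch1 (d node_x)) 0.
    by rewrite /root horner_coef0 node_coef0 d2 coef0.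
  by case/factor_theorem => h; rewrite subr0 mulrC; exists h.
have hc : h`_0 = ((h`_0)%:P)`_0 by rewrite coefC.
exists (mk_node hc); apply: node_inj; rewrite rmorphM /= !branchE //.
by rewrite mul0r d2.
Qed.

Let xdd_coef0 (x : node) :
  ('X * (branch1 x)^`()^`())`_0 = ('X * (branch2 x)^`()^`())`_0.
Proof. by rewrite !coef0_XM. Qed.

(** The operator [x d_x^2 + y d_y^2]; the factor [X] makes both constant terms zero, so the result
    stays in [node]. *)
Definition xdd (x : node) : node := mk_node (xdd_coef0 x).

Lemma Klinear_xdd : Klinear (in_alg node) xdd.
Proof.
split=> [x y|c x]; rewrite ?mulr_algl; apply: node_inj.
- by rewrite rmorphD /= !branchE rmorphD !derivD mulrDr.
- by rewrite rmorphD /= !branchE rmorphD !derivD mulrDr.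
- by rewrite linearZ /= !branchE linearZ /= !derivZ scalerAr.
by rewrite linearZ /= !branchE linearZ /= !derivZ scalerAr.
Qed.

Lemma is_diffop_xdd : is_diffop (in_alg node) xdd.
Proof.
exists 2; split; first exact: Klinear_xdd.
move=> r; split; first exact/Klinear_commutator/Klinear_xdd.
(* This element is [2 X r' s'] on each branch, written through [xdd] so that it visibly lies in
   [node]. *)
move=> s; exists (xdd (r * s) - r * xdd s - s * xdd r).
apply/funext => x; apply: node_inj; rewrite /commutator.
  rewrite !(rmorphM, rmorphB) /= !branchE !rmorphM /= !(derivM, derivD); ring.
rewrite !(rmorphM, rmorphB) /= !branchE !rmorphM /= !(derivM, derivD); ring.
Qed.

Definition node_delta : diffop node := Diffop is_diffop_xdd.

Lemma node_deltaE n : node_delta (node_f ^+ n.+1) = (n * n.+1)%:R * node_f ^+ n.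
Proof.
have h : 'X * ('X^(n.+1))^`()^`() = (n * n.+1)%:R * 'X^n :> {poly K}.
  rewrite derivXn derivMn derivXn /=.
  (* For [n = 0] the exponent [n.-1] is truncated and both sides vanish. *)
  case: n => [|n]; first by rewrite mul0n mulr0n mul0rn mulr0 mul0r.
  by rewrite !mulrnAr -exprS -mulrnA mulr_natl.
apply: node_inj; rewrite rmorphM rmorph_nat rmorphXn -h /= branchE;
  congr (_ * _^`()^`()).
  by rewrite rmorphXn.
by rewrite rmorphXn.
Qed.

Lemma node_BS_eqn : BS_eqn node_f ('X * ('X + 1)).
Proof.
apply/BS_eqnP; exists node_delta%:P => n; set b := 'X * _.
pose w := map_poly (in_alg node) b.
rewrite (@nat_to_int_functional_eqn _ _ _ _ w 1) => [|m].
  by rewrite -[n%:~R in LHS](rmorph_int (in_alg node)) horner_map.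
rewrite addn1 hornerC node_deltaE.
rewrite -[m%:R in RHS](rmorph_nat (in_alg node)) horner_map.
rewrite /b !hornerE /= natr1 -natrM -(rmorph_nat (in_alg node)).
by [].
Qed.

Lemma node_sandwich_root c : sandwich_eqn node_f c -> root c (-2%:R).
Proof.
move=> /(sandwich_eqn_eval diffop_node_x)[g gc].
have xf n : node_x * node_f ^+ n = node_x ^+ n.+1.
  apply: node_inj; rewrite rmorphM !rmorphXn /= !branchE.
    by rewrite exprS.
  by rewrite mul0r expr0n.
(* With [w = c(s) x] the equation [gc] takes the shape [g(n) x^(n+2) = w(n) x^n] that extends to
   [int], now with the localization at [x]. *)
pose w := map_poly (in_alg node) c * node_x%:P.
have wE (n : int) : w.[n%:~R] = c.[n%:~R] *: node_x.
  rewrite hornerM hornerC -[n%:~R in LHS](rmorph_int (in_alg node)) horner_map.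
  exact: mulr_algl.
have gw (n : nat) : g.[n%:R] (node_x ^+ (n + 2)) = w.[n%:R] * node_x ^+ n.
  by rewrite (wE n) -scalerAl -exprS -xf -gc xf addn2.
have := nat_to_int_functional_eqn gw (- 2%:Z).
rewrite addNr wE [loc_pow _ 0]/= ext_locE; move: (g.[_] _) => r.
rewrite /to_loc loc_mkM => /loc_mk_eqP[t] /(congr1 branch1).
rewrite !rmorphM !rmorphXn /= linearZ /= !branchE !mulr1 [branch1 r * _]mulrA.
have X0 : ('X : {poly K}) != 0 by rewrite polyX_eq0.
(* On the first branch, after cancelling [X^t] and one more [X], the constant [c(-2)] is a multiple
   of [X], hence 0. *)
rewrite -mul_polyC => e; have {}e := mulIf X0 (mulfI (expf_neq0 t X0) e).
by have := congr1 (coefp 0) e; rewrite /= coefMX coefC => /esym/eqP.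
Qed.

(** The Bernstein-Sato polynomial divides [s (s + 1)], whose value 2 at -2 is nonzero in
    characteristic 0, whereas -2 is a root of [c], even if [c = 0]. *)
Lemma node_BS_neq_sandwich : [pchar K] =i pred0 ->
  exists b c, [/\ is_BS_poly node_f b, is_sandwich_BS_poly node_f c & b != c].
Proof.
move=> K0; have nat0 := proj1 (pcharf0P K) K0.
have b0 : 'X * ('X + 1) != 0 :> {poly K}.
  rewrite mulf_neq0 ?polyX_eq0 //.
  by rewrite -size_poly_gt0 -[1]opprK -polyCN size_XsubC.
have [b bP] : exists b, is_BS_poly node_f b.
  apply: poly_ideal_monic_gen (BS_eqn_ideal node_f) _.
  by exists ('X * ('X + 1)) => //; exact: node_BS_eqn.
have [c [cm cP]] := poly_ideal_gen (sandwich_eqn_ideal node_f).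
exists b, c; split=> //; apply/eqP => bc.
have /node_sandwich_root c2 : sandwich_eqn node_f c by apply/cP.
have [_ bE] := proj1 (is_BS_polyP _ _) bP.
have /dvdpP[q qE] : b %| 'X * ('X + 1) by apply/bE/node_BS_eqn.
have : root ('X * ('X + 1)) (- 2%:R : K) by rewrite qE bc rootM c2 orbT.
rewrite /root !hornerE (_ : _ * _ = 2%:R) ?nat0 //; ring.
Qed.

End Node.

Theorem theorem1p4 :
  (forall (K : fieldType) (R : comAlgType K) (f : R),
     [pchar K] =i pred0 ->
     ((exists2 b, b != 0 & sandwich_eqn f b) ->
        exists b c, [/\ is_BS_poly f b, is_sandwich_BS_poly f c & b %| c])
     /\ (smooth R -> GRing.lreg f ->
           forall b, is_BS_poly f b <-> is_sandwich_BS_poly f b /\ b != 0))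
  /\ (exists (K : fieldType) (R : comAlgType K) (f : R),
        [/\ [pchar K] =i pred0, GRing.lreg f &
            exists b c, [/\ is_BS_poly f b, is_sandwich_BS_poly f c & b != c]]).
Proof.
split=> [K R f K0|].
  split=> [|sm fr b]; first exact: BS_poly_of_sandwich.
  exact: is_BS_poly_sandwich.
have rat0 : [pchar rat] =i pred0 by exact: Num.Theory.pchar_num.
exists rat, (node rat : comAlgType rat), (node_f rat); split=> //.
  exact: node_f_lreg.
exact: node_BS_neq_sandwich.
Qed.
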